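(* For all sufficiently large $n$, $t_2(n,C^* )=e_2(F_n)$, and $F_n$ is the unique $n$-vertex graph containing no even cycle that attains this maximum.
   Context: All graphs are finite, simple, undirected. For a graph $G$ with degree sequence $d_1,\ldots,d_n$, $e_2(G)=\sum_{i=1}^n d_i^2$. $C^*$ is the family of all even cycles, and $t_2(n,C^* )$ is the maximum of $e_2(G)$ over all $n$-vertex graphs $G$ containing no member of $C^*$ as a subgraph (i.e., no cycle of even length). The friendship graph $F_n$ is obtained from the star with $n$ vertices by adding a maximum matching on its set of $n-1$ leaves. *)

(* Defs.v *)
From mathcomp Require Import all_boot.
From mathcomp Require Import boolp.

Set Implicit Arguments.
Unset Strict Implicit.
Unset Printing Implicit Defensive.

(* A finite simple graph on V is a set of 2-element subsets of V. *)
Definition sgraph (V : finType) : predArgType :=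
  {E : {set {set V}} | [forall e in E, #|e| == 2]}.

Definition adj (V : finType) (G : sgraph V) : rel V :=
  fun x y => [set x; y] \in val G.

(* The n-vertex graphs, with vertex set {0, ..., n - 1}. *)
Notation graph n := (sgraph 'I_n).

Lemma adj_sym (V : finType) (G : sgraph V) : symmetric (adj G).
Proof. by move=> x y; rewrite /adj setUC. Qed.

Lemma adj_irrefl (V : finType) (G : sgraph V) : irreflexive (adj G).
Proof.
move=> x; apply/negP => Gx.
by have /forall_inP/(_ _ Gx) := valP G; rewrite setUid cards1.
Qed.

Definition edges_of (V : finType) (r : rel V) : {set {set V}} :=
  [set [set x; y] | x in V, y in V & (x != y) && r x y].

Lemma edges_ofP (V : finType) (r : rel V) :
  [forall e in edges_of r, #|e| == 2].
Proof.
apply/forall_inP => _ /imset2P[x y _ + ->].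
by rewrite inE => /andP[_ /andP[xy _]]; rewrite cards2 xy.
Qed.

(* The graph of the symmetric closure of r, with loops removed. *)
Definition graph_of (V : finType) (r : rel V) : sgraph V :=
  exist _ (edges_of r) (edges_ofP r).

Lemma adj_graph_of (V : finType) (r : rel V) x y :
  adj (graph_of r) x y = (x != y) && (r x y || r y x).
Proof.
apply/imset2P/andP => [[a b _ + E]|[xy /orP[rxy|ryx]]].
- rewrite inE => /andP[_ /andP[ab rab]].
  have : x \in [set a; b] by rewrite -E !inE eqxx.
  have : y \in [set a; b] by rewrite -E !inE eqxx orbT.
  have : a \in [set x; y] by rewrite E !inE eqxx.
  have : b \in [set x; y] by rewrite E !inE eqxx orbT.
  rewrite !inE => /orP[]/eqP bE /orP[]/eqP aE _ _; subst a b.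
  + by rewrite eqxx in ab.
  + by rewrite eq_sym ab rab orbT.
  + by rewrite ab rab.
  + by rewrite eqxx in ab.
- by exists x y; rewrite ?inE ?xy.
- by exists y x; rewrite ?inE 1?eq_sym ?xy // setUC.
Qed.

Definition degree (V : finType) (G : sgraph V) (v : V) : nat :=
  #|[set w | adj G v w]|.

Definition e2 (V : finType) (G : sgraph V) : nat :=
  \sum_(v : V) degree G v ^ 2.

(* G contains H as a (not necessarily induced) subgraph. *)
Definition contains (U V : finType) (G : sgraph V) (H : sgraph U) : Prop :=
  exists2 f : U -> V, injective f & forall x y, adj H x y -> adj G (f x) (f y).

Definition isomorphic (U V : finType) (G : sgraph U) (H : sgraph V) : Prop :=
  exists2 f : U -> V, bijective f & forall x y, adj H (f x) (f y) = adj G x y.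

Definition family := forall k : nat, graph k -> Prop.

Definition free (F : family) (V : finType) (G : sgraph V) : Prop :=
  forall (k : nat) (H : graph k), F k H -> ~ contains G H.

Definition t2 (n : nat) (F : family) : nat :=
  \max_(G : graph n | `[< free F G >]) e2 G.

(* ordS is the cyclic successor; this is the cycle of length k if k >= 3. *)
Definition cycle_graph (k : nat) : graph k :=
  graph_of (fun x y => y == ordS x).

Definition even_cycles : family :=
  fun k H => [/\ 2 < k, ~~ odd k & H = cycle_graph k].

(* The star centred at 0, together with the matching {1,2}, {3,4}, ... of its
   leaves 1, ..., n - 1; the leaf n - 1 is unmatched when n - 1 is odd. *)
Definition friendship (n : nat) : graph n :=
  graph_of (fun x y : 'I_n =>
    (x == 0 :> nat) || odd x && (y == x.+1 :> nat)).

(* Main.v *)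
Require Import Defs.
From mathcomp Require Import all_boot.
From mathcomp Require Import boolp zify.

(** A longest path argument shows that a nonempty graph without even cycles has
    a vertex of degree at most 1 or two adjacent vertices of degree at most 2;
    removing them repeatedly gives [sum_v d(v) <= 3 (n - 1)].  Since there is no
    4-cycle, two distinct vertices have at most one common neighbour, so
    counting 2-paths by their end points gives
    [e2 G <= sum_v d(v) + n (n - 1) - D], where [D] is the (even) number of
    ordered pairs of distinct vertices without a common neighbour.  If [D >= 4] then [e2 G] is smaller than [e2] of the
    friendship graph.  If at most one unordered pair has no common neighbour, a
    vertex of degree at most 2 and the absence of 4- and 6-cycles produce a
    vertex adjacent to all the others; the remaining edges form a matching
    missing at most one leaf. *)

Set Implicit Arguments.
Unset Strict Implicit.
Unset Printing Implicit Defensive.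

(** * Longest paths in graphs without even cycles *)

Definition even_cycle_free (V : finType) (r : rel V) : Prop :=
  forall c : seq V, uniq c -> cycle r c -> 2 < size c -> odd (size c).

Definition deg_in (V : finType) (r : rel V) (S : {set V}) (x : V) : nat :=
  #|[set y in S | r x y]|.

Definition is_path (V : finType) (r : rel V) (S : {set V}) (v : nat -> V)
    (m : nat) : Prop :=
  [/\ forall k, k <= m -> v k \in S,
      forall i j, i <= m -> j <= m -> v i = v j -> i = j &
      forall k, k < m -> r (v k) (v k.+1)].

Definition longest_path (V : finType) (r : rel V) (S : {set V}) (v : nat -> V)
    (m : nat) : Prop :=
  is_path r S v m /\ forall v' m', is_path r S v' m' -> m' <= m.

(* [lia] is slow on the boolean hypotheses that are not about [nat]. *)
Ltac nat_lia :=
  repeat match goal with H : is_true ?b |- _ =>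
    lazymatch b with
    | leq _ _ => fail
    | andb (leq _ _) (leq _ _) => fail
    | odd _ => fail
    | negb (odd _) => fail
    | _ => clear H
    end
  end; lia.

Lemma path_segment (V : finType) (r : rel V) (v : nat -> V) x i d :
  r x (v i) -> (forall k, i <= k < i + d -> r (v k) (v k.+1)) ->
  path r x [seq v k | k <- iota i d.+1].
Proof.
elim: d x i => [|d IHd] x i /= rx rv; first by rewrite rx.
rewrite rx; apply: IHd => [|k /andP[ik kd]]; first by apply: rv; lia.
by apply: rv; lia.
Qed.

(** The vertices [x], [xs], [v i], ..., [v (i + d)] form a cycle of length [size xs + d + 2], which
    has the parity of [size xs + d]; the last hypothesis makes this length exceed 2. All parity
    arguments on paths below are instances. *)
Lemma odd_closing_segment (V : finType) (r : rel V) S v m x xs i d :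
    even_cycle_free r -> is_path r S v m -> i + d <= m ->
    path r x (rcons xs (v i)) -> r (v (i + d)) x -> uniq (x :: xs) ->
    (forall k, i <= k <= i + d -> v k \notin x :: xs) -> 0 < size xs + d ->
  odd (size xs + d).
Proof.
move=> ecf [_ vI vr] idm px rx ux nx gt0.
have := ecf ((x :: xs) ++ [seq v k | k <- iota i d.+1]).
rewrite size_cat size_map size_iota.
have -> : odd (size (x :: xs) + d.+1) = odd (size xs + d).
  by rewrite /= addnS /= negbK.
apply; last by rewrite /=; nat_lia.
- rewrite cat_uniq ux map_inj_in_uniq ?iota_uniq ?andbT.
    apply/hasPn => _ /mapP[k + ->]; rewrite mem_iota => ki.
    by apply: nx; nat_lia.
  by move=> k l; rewrite !mem_iota => kI lI; apply: vI; nat_lia.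
- rewrite /= rcons_path cat_path; move: px; rewrite rcons_path => /andP[-> rl].
  rewrite path_segment //=; last by move=> k ki; apply: vr; nat_lia.
  rewrite last_cat.
  suff -> : last (last x xs) [seq v k | k <- iota i d.+1] = v (i + d) by [].
  by rewrite -addn1 iotaD map_cat last_cat.
Qed.

(** The chord closes [v i], ..., [v j] into a cycle of length [j - i + 1]. *)
Lemma chord_even (V : finType) (r : rel V) S v m i j :
    even_cycle_free r -> is_path r S v m -> i.+1 < j -> j <= m ->
  r (v j) (v i) -> ~~ odd (j - i).
Proof.
move=> ecf vP ij jm rji; have [_ vI vr] := vP.
have := @odd_closing_segment V r S v m (v i) [::] i.+1 (j - i.+1) ecf vP.
rewrite subnKC; last by nat_lia.
move=> /(_ jm); rewrite /= andbT => /(_ (vr _ _) rji isT) H.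
have : odd (0 + (j - i.+1)).
  apply: H; [nat_lia| |nat_lia] => k ki; rewrite inE; apply/eqP => /vI H.
  nat_lia.
nat_lia.
Qed.

(** A neighbour off the path could be prepended to it. *)
Lemma longest_path_nbr (V : finType) (r : rel V) S v m y :
    symmetric r -> longest_path r S v m -> y \in S -> r (v 0) y ->
  exists2 j, j <= m & y = v j.
Proof.
move=> rS [[vS vI vr] vmax] yS r0y.
have [/existsP[j /eqP ->]|/existsPn yN] := boolP [exists j : 'I_m.+1, y == v j].
  by exists j => //; rewrite -ltnS.
have yv k : k <= m -> y <> v k.
  by move=> km yk; have := yN (Ordinal (km : k < m.+1)); rewrite /= yk eqxx.
suff : m.+1 <= m by nat_lia.
apply: (vmax (fun k => if k is k'.+1 then v k' else y)); split.
- by case=> // k; apply: vS.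
- case=> [|i] [|j] //= im jm; first by move/yv; case.
    by move/esym/yv; case.
  by move/vI => ->.
- by case=> [|k] km; [rewrite rS|apply: vr].
Qed.

Lemma longest_path_end (V : finType) (r : rel V) S v m :
    symmetric r -> irreflexive r -> even_cycle_free r -> longest_path r S v m ->
  deg_in r S (v 0) <= 1 \/
  exists i, [/\ 1 < i, i <= m, r (v 0) (v i) & deg_in r S (v 0) <= 2].
Proof.
move=> rS rI ecf vL; have [vP _] := vL; have [_ vI vr] := vP.
have [/existsP[i /andP[i1 r0i]]|/existsPn iN] :=
  boolP [exists i : 'I_m.+1, (1 < i) && r (v 0) (v i)].
- right; exists i; split=> //; first by rewrite -ltnS.
  suff : [set y in S | r (v 0) y] \subset [set v 1; v i].
    by move/subset_leq_card/leq_trans; apply; rewrite cards2; case: eqP.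
  apply/subsetP => y; rewrite !inE => /andP[yS r0y].
  have [j jm yj] := longest_path_nbr rS vL yS r0y; subst y.
  case: j jm r0y {yS} => [|[|j]] jm r0j; rewrite ?eqxx //.
    by rewrite rI in r0j.
  (* Chords from [v 0] to [v k] and [v l] force [k] and [l] to be even, while the cycle through
     [v 0] and the segment from [v k] to [v l] forces [l - k] to be odd. *)
  suff N k l : 1 < k -> k < l -> l <= m -> r (v 0) (v k) -> r (v 0) (v l) ->
      False.
    have := ltn_ord i; rewrite ltnS => im.
    have [lt|gt|->] := ltngtP i j.+2; last by rewrite eqxx orbT.
      by case: (N i j.+2).
    by case: (N j.+2 i).
  move=> k1 kl lm r0k r0l.
  have := @odd_closing_segment V r S v m (v 0) [::] k (l - k) ecf vP.
  have {}r0l' : r (v l) (v 0) by rewrite rS.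
  rewrite subnKC ?(ltnW kl) //= r0k => /(_ lm isT r0l' isT) H.
  have : odd (0 + (l - k)).
    by apply: H; [|nat_lia] => q ql; rewrite inE; apply/eqP => /vI H; nat_lia.
  have e1 := @chord_even V r S v m 0 l ecf vP.
  have e2 := @chord_even V r S v m 0 k ecf vP.
  have := e1 _ lm r0l'; have := e2 k1 _; rewrite (rS (v k)) => /(_ _ r0k).
  nat_lia.
- left; suff : [set y in S | r (v 0) y] \subset [set v 1].
    by move/subset_leq_card/leq_trans; apply; rewrite cards1.
  apply/subsetP => y; rewrite !inE => /andP[yS r0y].
  have [j jm yj] := longest_path_nbr rS vL yS r0y; subst y.
  case: j jm r0y {yS} => [|[|j]] jm r0j; rewrite ?eqxx //.
    by rewrite rI in r0j.
  by have := iN (Ordinal (jm : j.+2 < m.+1)); rewrite /= r0j.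
Qed.

Lemma longest_path_exists (V : finType) (r : rel V) (S : {set V}) :
  S != set0 -> exists v m, longest_path r S v m.
Proof.
case/set0Pn => x xS.
pose P m := `[< exists v, is_path r S v m >].
have exP : exists m, P m.
  exists 0; apply/asboolP; exists (fun=> x); split=> //.
  by move=> i j; nat_lia.
have bP m : P m -> m <= #|V|.
  move=> /asboolP[v [_ vI _]].
  have /leq_card : injective (fun i : 'I_m.+1 => v i).
    by move=> i j /vI H; apply/val_inj/H; rewrite -ltnS.
  by rewrite card_ord => /ltnW.
case: (ex_maxnP exP bP) => m /asboolP[v vP] mmax.
by exists v, m; split=> // v' m' v'P; apply: mmax; apply/asboolP; exists v'.
Qed.

(** On a longest path, either [v 0] has degree at most 1, or [v 0] and [v 1] are the adjacent pair,
    or [v 1] has a further neighbour [w], which then has degree at most 1. *)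
Lemma low_degree (V : finType) (r : rel V) (S : {set V}) :
    symmetric r -> irreflexive r -> even_cycle_free r -> S != set0 ->
  exists2 x, x \in S & deg_in r S x <= 1 \/
  deg_in r S x <= 2 /\ exists y, [/\ y \in S, r x y & deg_in r S y <= 2].
Proof.
move=> rS rI ecf S0; have [v [m vL]] := longest_path_exists r S0.
have [vP vmax] := vL; have [vS vI vr] := vP.
have v0S : v 0 \in S by apply: vS.
have [d1|[i [i1 im r0i d2]]] := longest_path_end rS rI ecf vL.
  by exists (v 0) => //; left.
have i_even : ~~ odd i.
  by have := @chord_even V r S v m 0 i ecf vP i1 im; rewrite subn0 rS; apply.
have v1S : v 1 \in S by apply: vS; nat_lia.
have r01 : r (v 0) (v 1) by apply: vr; nat_lia.
have [/existsP[w /and4P[wS r1w w0 w2]]|/existsPn wN] :=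
  boolP [exists w, [&& w \in S, r (v 1) w, w != v 0 & w != v 2]]; last first.
  exists (v 0) => //; right; split=> //; exists (v 1); split=> //.
  suff : [set y in S | r (v 1) y] \subset [set v 0; v 2].
    by move/subset_leq_card/leq_trans; apply; rewrite cards2; case: eqP.
  apply/subsetP => y; rewrite !inE => /andP[yS r1y].
  by have := wN y; rewrite yS r1y /=; case: eqP => //= _; rewrite negbK.
(* If [w] is some [v j], then [j] is odd while [i] is even, and the edges from [v 0] to [v i] and
   [v 1] and from [v 1] to [v j] close the segment between [v i] and [v j] into an even cycle. *)
have [/existsP[[j jm] /= /eqP wj]|/existsPn wN] :=
  boolP [exists j : 'I_m.+1, w == v j].
  subst w; exfalso.
  have j2 : 2 < j.
    case: j {jm wS} r1w w0 w2 => [|[|[|j]]]; rewrite ?eqxx //.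
    by rewrite rI.
  have rj1 : r (v j) (v 1) by rewrite rS.
  have j_odd := chord_even ecf vP (j2 : 2 < j) jm rj1.
  have [ij|ji|ij] := ltngtP i j; last by nat_lia.
    have := @odd_closing_segment V r S v m (v 1) [:: v 0] i (j - i) ecf vP.
    rewrite subnKC ?(ltnW ij) //= rS r01 r0i inE.
    have v10 : v 1 != v 0 by apply/eqP => /vI; nat_lia.
    move=> /(_ jm isT rj1); rewrite v10 => /(_ isT) H.
    have : odd (1 + (j - i)); last by nat_lia.
    apply: H; last by nat_lia.
    by move=> k kij; rewrite !inE negb_or; apply/andP; split;
       apply/eqP => /vI; nat_lia.
  have := @odd_closing_segment V r S v m (v 0) [:: v 1] j (i - j) ecf vP.
  rewrite subnKC ?(ltnW ji) //= r01 r1w inE (rS (v i)) r0i.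
  have v10 : v 0 != v 1 by apply/eqP => /vI; nat_lia.
  move=> /(_ im isT isT); rewrite v10 => /(_ isT) H.
  have : odd (1 + (i - j)); last by nat_lia.
  apply: H; last by nat_lia.
  by move=> k kij; rewrite !inE negb_or; apply/andP; split;
     apply/eqP => /vI; nat_lia.
(* Now [w] is off the path, so replacing [v 0] by [w] gives another longest path, and
   [longest_path_end] applies to [w]. *)
have wv k : k <= m -> v k != w.
  by move=> km; have := wN (Ordinal (km : k < m.+1)); rewrite /= eq_sym.
pose v' k := if k is 0 then w else v k.
have v'L : longest_path r S v' m.
  split=> //; split.
  - by case=> [|k] km /=; [|apply: vS].
  - case=> [|k] [|l] //= km lm; last exact: vI.
      by move/eqP; rewrite eq_sym (negPf (wv _ lm)).
    by move/eqP; rewrite (negPf (wv _ km)).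
  - by case=> [|k] km /=; [rewrite rS|apply: vr].
have [d1|[j [j1 jm r0j _]]] := longest_path_end rS rI ecf v'L.
  by exists w => //; left.
exfalso.
have rwj : r w (v j) by case: j j1 r0j {jm}.
have j_even : ~~ odd j.
  have := @chord_even V r S v' m 0 j ecf v'L.1 j1 jm; rewrite subn0 rS; exact.
(* The cycles through v 0 and through w share the edge {v 1, v 2}. *)
have C x y k l : r x (v 1) -> r y (v 1) -> r x (v k) -> r y (v l) -> x != y ->
    (forall q, 1 <= q <= m -> v q != x) ->
    (forall q, 1 <= q <= m -> v q != y) ->
    1 < k -> k <= l -> l <= m -> ~~ odd k -> ~~ odd l -> False.
  move=> rx1 ry1 rxk ryl xy vx vy k1 kl lm ke le.
  have := @odd_closing_segment V r S v m y [:: v 1; x] k (l - k) ecf vP.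
  have y1 : y != v 1 by rewrite eq_sym vy //; nat_lia.
  have x1 : v 1 != x by rewrite vx //; nat_lia.
  rewrite subnKC //= ry1 (rS (v 1)) rx1 rxk (rS (v l)) ryl !inE.
  rewrite negb_or y1 eq_sym xy x1 => /(_ lm isT isT isT) H.
  have : odd (2 + (l - k)); last by nat_lia.
  apply: H; last by nat_lia.
  move=> q qkl; rewrite !inE !negb_or vx ?vy ?andbT /=; try nat_lia.
  by apply/eqP => /vI; nat_lia.
have rw1 : r w (v 1) by rewrite rS.
have v0q q : 1 <= q <= m -> v q != v 0 by move=> qm; apply/eqP => /vI; nat_lia.
have wq q : 1 <= q <= m -> v q != w by move=> qm; apply: wv; nat_lia.
have [ij|ji] := leqP i j; first by apply: (C (v 0) w i j) => //; rewrite eq_sym.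
by apply: (C w (v 0) j i) => //; nat_lia.
Qed.

(** * The degree sum *)

Lemma deg_in_setD1 (V : finType) (r : rel V) (S : {set V}) x y :
  x \in S -> deg_in r S y = r y x + deg_in r (S :\ x) y.
Proof.
move=> xS; rewrite /deg_in (cardsD1 x) inE xS /=; congr (_ + _).
by apply: eq_card => z; rewrite !inE andbA.
Qed.

Lemma sum_deg_setD1 (V : finType) (r : rel V) (S : {set V}) x :
    symmetric r -> irreflexive r -> x \in S ->
  \sum_(y in S) deg_in r S y =
  \sum_(y in S :\ x) deg_in r (S :\ x) y + 2 * deg_in r S x.
Proof.
move=> rS rI xS; rewrite (big_setD1 x) //=.
rewrite (eq_bigr (fun y => r x y + deg_in r (S :\ x) y)); last first.
  by move=> y _; rewrite (deg_in_setD1 _ _ xS) rS.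
rewrite big_split /=.
suff -> : \sum_(y in S :\ x) r x y = deg_in r S x by nat_lia.
rewrite (deg_in_setD1 _ _ xS) rI /deg_in add0n -sum1_card big_mkcond.
rewrite [RHS]big_mkcond; apply: eq_bigr => y _; rewrite !inE.
by case: (_ && _); case: (r x y).
Qed.

(** Deleting a vertex of degree at most 1 costs at most 2; deleting two adjacent vertices of degree
    at most 2 costs at most 2 * 2 + 2 * 1 = 6. So each deleted vertex costs at most 3, and the last
    one costs 0, whence the summand 3 on the left. *)
Lemma sum_deg_le (V : finType) (r : rel V) (S : {set V}) :
    symmetric r -> irreflexive r -> even_cycle_free r -> S != set0 ->
  \sum_(x in S) deg_in r S x + 3 <= 3 * #|S|.
Proof.
move=> rS rI ecf; have [n] := ubnP #|S|; elim: n S => // n IHn S Sn S0.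
have deg_lt z : z \in S -> deg_in r S z <= #|S :\ z|.
  move=> zS; apply/subset_leq_card/subsetP => y; rewrite !inE => /andP[-> rzy].
  by rewrite andbT; apply: contraTneq rzy => ->; rewrite rI.
have one x : x \in S -> deg_in r S x <= 1 ->
    \sum_(x in S) deg_in r S x + 3 <= 3 * #|S|.
  move=> xS d1; rewrite (sum_deg_setD1 rS rI xS).
  have := cardsD1 x S; rewrite xS => Sx.
  have [E|ne] := eqVneq (S :\ x) set0.
    by have := deg_lt x xS; rewrite E big_set0 cards0; nat_lia.
  by have := IHn (S :\ x) _ ne; nat_lia.
have [x xS [/one->//|[dx2 [y [yS rxy dy2]]]]] := low_degree rS rI ecf S0.
have [/one->//|dx1] := leqP (deg_in r S x) 1.
have ySx : y \in S :\ x.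
  by rewrite !inE yS andbT; apply: contraTneq rxy => ->; rewrite rI.
rewrite (sum_deg_setD1 rS rI xS) (sum_deg_setD1 rS rI ySx).
have := deg_in_setD1 r y xS; rewrite rS rxy.
have := cardsD1 x S; rewrite xS; have := cardsD1 y (S :\ x); rewrite ySx.
have := deg_lt x xS; move=> h1 h2 h3 h4.
(* [x] has two neighbours in [S], so one remains after deleting [y]. *)
have ne : S :\ x :\ y != set0 by rewrite -card_gt0; nat_lia.
have := IHn _ _ ne; nat_lia.
Qed.

(** * Counting 2-paths by their end points *)

Definition far (V : finType) (r : rel V) : rel V :=
  fun x y => (x != y) && ~~ [exists z, r x z && r y z].

Lemma far_sym (V : finType) (r : rel V) : symmetric (far r).
Proof.
move=> x y; rewrite /far eq_sym; congr (_ && ~~ _).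
by apply: eq_existsb => z; rewrite andbC.
Qed.

Lemma nfarP (V : finType) (r : rel V) x y :
  x != y -> ~~ far r x y -> exists2 z, r x z & r y z.
Proof.
by rewrite /far => ->; rewrite negbK => /existsP[z /andP[]]; exists z.
Qed.

Lemma common_nbr_uniq (V : finType) (r : rel V) x y z w :
    symmetric r -> irreflexive r -> even_cycle_free r -> x != y ->
  r x z -> r y z -> r x w -> r y w -> z = w.
Proof.
move=> rS rI ecf xy xz yz xw yw; apply/eqP; apply: contraT => zw.
have N u v : r u v -> u != v by apply: contraTneq => ->; rewrite rI.
have := ecf [:: x; z; y; w].
rewrite /= !inE !negb_or xy zw !N // ?xz 1?rS ?yz ?yw 1?rS ?xw //=.
by move=> /(_ isT isT isT).
Qed.

(** The squares count walks [y], [x], [z]. Fixed ends [y] and [z] allow [deg_in r setT y] walks if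
    they are equal, otherwise at most one, and none if they are far. *)
Lemma sum_sq_deg (V : finType) (r : rel V) :
    symmetric r -> irreflexive r -> even_cycle_free r ->
  \sum_x deg_in r setT x ^ 2 + #|[set p | far r p.1 p.2]| + #|V| <=
  \sum_x deg_in r setT x + #|V| * #|V|.
Proof.
move=> rS rI ecf.
have degE x : deg_in r setT x = \sum_y r x y.
  rewrite /deg_in -sum1_card big_mkcond; apply: eq_bigr => y _.
  by rewrite !inE; case: (r x y).
have -> : \sum_x deg_in r setT x ^ 2 = \sum_y \sum_z \sum_x r x y * r x z.
  rewrite (eq_bigr (fun x => \sum_y \sum_z r x y * r x z)).
    by rewrite exchange_big; apply: eq_bigr => y _; rewrite exchange_big.
  move=> x _; rewrite degE -mulnn big_distrl; apply: eq_bigr => y _.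
  by rewrite big_distrr.
have -> : #|[set p | far r p.1 p.2]| = \sum_y \sum_z far r y z.
  rewrite pair_bigA -sum1_card big_mkcond; apply: eq_bigr => p _.
  by rewrite !inE; case: (far r _ _).
have -> : #|V| * #|V| = \sum_(y : V) #|V| by rewrite sum_nat_const.
rewrite -[X in _ + X <= _]sum1_card -!big_split /=; apply: leq_sum => y _.
(* Terms in [y] alone become sums over [z] supported at [z = y], so that the two sides can be
   compared pair by pair. *)
have one F : F y = \sum_(z : V) (y == z) * F z.
  rewrite (bigD1 y) //= eqxx mul1n big1 ?addn0 // => z /negPf.
  by rewrite eq_sym => ->.
rewrite (one (fun=> 1)) (one (deg_in r setT)) -[#|V|]sum1_card -!big_split /=.
apply: leq_sum => z _; have [->|yz] := eqVneq y z.
  rewrite /far eqxx /= addn0 !mul1n leq_add2r degE; apply: leq_sum => x _.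
  by rewrite rS; case: (r z x).
rewrite !addn0 !add0n /far yz /=.
have [/existsP[x /andP[yx zx]]|/existsPn H] := boolP [exists w, r y w && r z w].
  rewrite addn0 (bigD1 x) //= big1 => [|w wx].
    by case: (r x y); case: (r x z).
  rewrite ![r w _]rS; case yw: (r y w) => //; case zw: (r z w) => //.
  by rewrite (common_nbr_uniq rS rI ecf yz yw zw yx zx) eqxx in wx.
rewrite big1 // => x _; have := H x; rewrite ![r x _]rS.
by case: (r y x); case: (r z x).
Qed.

(** * A vertex adjacent to all others *)

Lemma exists_notin (V : finType) (s : seq V) :
  size s < #|V| -> exists x, x \notin s.
Proof.
move=> sV; apply/existsP; apply: contraLR sV; rewrite negb_exists -leqNgt.
move/forallP => H; rewrite cardE; apply: uniq_leq_size; first exact: enum_uniq.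
by move=> x _; have := H x; rewrite negbK.
Qed.

(** Each unordered far pair gives two ordered ones, so two different far pairs would give four. *)
Lemma far_uniq (V : finType) (r : rel V) x y z w :
    #|[set p | far r p.1 p.2]| < 4 -> far r x y -> far r z w ->
  (z == x) && (w == y) || (z == y) && (w == x).
Proof.
move=> D4 xy zw; apply: contraLR D4; rewrite negb_or => /andP[n1 n2].
rewrite -leqNgt.
have [xNy zNw] : x != y /\ z != w by move: xy zw => /andP[-> _] /andP[-> _].
have <- : size [:: (x, y); (y, x); (z, w); (w, z)] = 4 by [].
rewrite cardE; apply: uniq_leq_size.
  move: n1 n2; rewrite /= !inE !xpair_eqE !negb_or /=.
  rewrite ![_ == z]eq_sym ![_ == w]eq_sym ![w == z]eq_sym (eq_sym y x).
  rewrite ?(negPf xNy) ?(negPf zNw).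
  by case: (z == x); case: (z == y); case: (w == x); case: (w == y).
move=> p; rewrite mem_enum !inE.
by case/or4P => /eqP -> /=; rewrite // far_sym.
Qed.

(** A vertex [u] of degree at most 2 is linked to every vertex not far from it through one of its
    neighbours, and at most one vertex is far from it. One of these neighbours turns out to
    dominate. *)
Lemma dominating_vertex (V : finType) (r : rel V) :
    symmetric r -> irreflexive r -> even_cycle_free r -> 6 < #|V| ->
    #|[set p | far r p.1 p.2]| < 4 ->
  exists b, forall w, w != b -> r b w.
Proof.
move=> rS rI ecf V6 D4.
have N u v : r u v -> u != v by apply: contraTneq => ->; rewrite rI.
have cn x y z w := @common_nbr_uniq V r x y z w rS rI ecf.
have fu x y z w := @far_uniq V r x y z w D4.
have VT : [set: V] != set0 by rewrite -card_gt0 cardsT; apply: leq_trans V6.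
have [u du] : exists u, deg_in r setT u <= 2.
  have [u _ H] := low_degree rS rI ecf VT; exists u.
  by case: H => [/leq_trans->|[]].
have nbr w : r u w = (w \in [set w in setT | r u w]) by rewrite !inE.
have u_far w : w != u -> (forall c, r u c -> ~~ r w c) -> far r u w.
  rewrite /far eq_sym => -> /= H; apply/existsPn => c.
  by have [/H|] := boolP (r u c).
move: du; rewrite /deg_in leq_eqVlt => /orP[/cards2P[a [b [ab E]]]|].
  have {}nbr w : r u w = (w == a) || (w == b) by rewrite nbr E !inE.
  have ua : r u a by rewrite nbr eqxx.
  have ub : r u b by rewrite nbr eqxx orbT.
  have [ru rub] : r a u /\ r b u by rewrite ![r _ u]rS.
  (* [c] is the candidate and [d] the other neighbour of [u]. *)
  have dom c d : r u c -> r u d -> (forall w, r u w -> (w == c) || (w == d)) ->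
      c != d -> (forall w, w \notin [:: u; c; d] -> r w c || far r u w) ->
      exists b, forall w, w != b -> r b w.
    move=> uc ud ucd cd H.
    have fcd : far r u d -> False.
      move=> fd; have fc : far r u c.
        apply: u_far; first by rewrite eq_sym N.
        move=> e /ucd /orP[] /eqP ->; first by rewrite rI.
        apply: contraL fd => rcd; rewrite /far N //= negbK.
        by apply/existsP; exists c; rewrite uc rS.
      have := fu _ _ _ _ fd fc.
      by rewrite (negPf cd) (negPf (N _ _ ud)) !andbF.
    have rcd : r c d.
      have /nfarP[] : ~~ far r u d by apply/negP.
      - exact: N.
      - by move=> e /ucd /orP[] /eqP -> //; rewrite rS // rI.
    (* A vertex [w0] missed by [c] is far from [u]; this is then the only far pair, and [c] is
       adjacent to all vertices other than [c] and [w0]. *)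
    have [/existsP[w0 /andP[w0N w0c]]|/existsPn H'] :=
      boolP [exists w, (w \notin [:: u; c; d]) && ~~ r w c]; last first.
      exists c => w wc; have := H' w; rewrite !inE (negPf wc) /=.
      have [->|wu] := eqVneq w u; first by rewrite (rS c).
      have [->//|wd] := eqVneq w d; by rewrite negbK (rS c).
    have fw0 : far r u w0 by have := H _ w0N; rewrite (negPf w0c).
    move: (w0N); rewrite !inE !negb_or => /and3P[w0u w0c' w0d].
    have good x y : x != y -> x != u -> y != u -> exists2 z, r x z & r y z.
      move=> xy xu yu; apply: nfarP => //; apply/negP => fxy.
      by have := fu _ _ _ _ fw0 fxy; rewrite (negPf xu) (negPf yu) !andbF.
    have rc w : w != c -> w != w0 -> r c w.
      have [->|wu] := eqVneq w u; first by rewrite rS.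
      have [->//|wd wc ww0] := eqVneq w d.
      have := H w; rewrite !inE !negb_or wu wd wc => /(_ isT).
      rewrite (rS w) => /orP[//|fw].
      have := fu _ _ _ _ fw0 fw.
      by rewrite (negPf ww0) (negPf wu) !andbF.
    have uw0 : r u w0 = false.
      by apply/negP => /ucd; rewrite (negPf w0c') (negPf w0d).
    have cu : c != u by rewrite eq_sym N.
    have [z cz w0z] : exists2 z, r c z & r w0 z.
      by apply: good; rewrite // eq_sym.
    (* A common neighbour of [w] and [w0] is adjacent to [c], hence equals [z], the only common
       neighbour of [c] and [w0]. Two such [w] will be two common neighbours of [c] and [z]. *)
    have near w : w \notin [:: u; c; z; w0] -> r c w /\ r z w.
      rewrite !inE !negb_or => /and4P[wu wc wz ww0]; split; first exact: rc.
      have [y wy w0y] := good _ _ ww0 wu w0u.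
      suff -> : z = y by rewrite rS.
      apply: (cn c w0) => //; first by rewrite eq_sym.
      apply: rc.
        by apply: contraNneq w0c => <-.
      by rewrite eq_sym N.
    have [x xN] : exists x, x \notin [:: u; c; z; w0].
      by apply/exists_notin/(leq_trans _ V6).
    have [y yN] : exists y, y \notin [:: x; u; c; z; w0].
      by apply/exists_notin/(leq_trans _ V6).
    move: yN; rewrite inE negb_or => /andP[yx yN].
    have [[cx zx] [cy zy]] := (near _ xN, near _ yN).
    by rewrite (cn c z x y) ?eqxx ?N in yx.
  (* [dom] settles the case unless some [w] misses [a] and some [x] misses [b], neither of them far
     from [u]. *)
  have [/existsP[w /and3P[wN wfar wa]]|/existsPn H] :=
    boolP [exists w, [&& w \notin [:: u; a; b], ~~ far r u w & ~~ r w a]];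
    last first.
    apply: (dom a b) => // [w|w wN]; first by rewrite nbr.
    by have := H w; rewrite wN /= negb_and !negbK orbC.
  have [/existsP[x /and3P[xN xfar xb]]|/existsPn H] :=
    boolP [exists w, [&& w \notin [:: u; a; b], ~~ far r u w & ~~ r w b]];
    last first.
    apply: (dom b a) => // [w'||w' w'N].
    - by rewrite nbr orbC.
    - by rewrite eq_sym.
    - have := H w'; move: w'N; rewrite !inE !negb_or => /and3P[-> -> ->] /=.
      by rewrite negb_and !negbK orbC.
  exfalso.
  have side y : y \notin [:: u; a; b] -> ~~ far r u y -> r y a || r y b.
    rewrite inE negb_or => /andP[yu _] /nfarP; rewrite eq_sym => /(_ yu)[z].
    by rewrite nbr => /orP[] /eqP -> ->; rewrite ?orbT.
  have {}wb : r w b by have := side _ wN wfar; rewrite (negPf wa).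
  have {}xa : r x a by have := side _ xN xfar; rewrite (negPf xb) orbF.
  (* a common neighbour z of y and y' would close the 6-cycle u a y z y' b *)
  have far_ab y y' : y \notin [:: u; a; b] -> y' \notin [:: u; a; b] ->
      r y a -> r y' b -> far r y y'.
    rewrite !inE !negb_or => /and3P[yu ya yb] /and3P[y'u y'a y'b] rya ry'b.
    have yy' : y != y'.
      apply: contra_neq ab => E'; subst y'.
      by apply: (cn u y) => //; rewrite eq_sym.
    rewrite /far yy' /=; apply/existsPn => z; apply/negP => /andP[yz y'z].
    have zu : z != u.
      by apply: contraTneq yz => ->; rewrite rS nbr (negPf ya) (negPf yb).
    have za : z != a.
      apply: contraTneq y'z => ->; apply/negP => y'a'.
      by case/eqP: ab; apply: (cn u y') => //; rewrite eq_sym.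
    have zb : z != b.
      apply: contraTneq yz => ->; apply/negP => yb'.
      by case/eqP: ab; apply: (cn u y) => //; rewrite eq_sym.
    have := ecf [:: u; a; y; z; y'; b].
    rewrite /= !inE !negb_or ab yy' !(N _ _ yz) (N _ _ ua) (N _ _ ub).
    rewrite (eq_sym z y') (N _ _ y'z) (eq_sym a z) za zb y'b yb.
    rewrite (eq_sym u) yu (eq_sym u) zu (eq_sym u) y'u.
    rewrite (eq_sym a) ya (eq_sym a) y'a /=.
    rewrite ua (rS a) rya yz (rS z) y'z ry'b rub.
    by move=> /(_ isT isT isT).
  (* This is the only far pair, but any further vertex [y] is adjacent to [a] or [b], hence far from
     [w] or from [x]. *)
  have fxw := far_ab _ _ xN wN xa wb.
  have [y yN] : exists y, y \notin [:: u; a; b; x; w].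
    by apply/exists_notin/(leq_trans _ V6).
  have [yN' yx yw] : [/\ y \notin [:: u; a; b], y != x & y != w].
    move: yN; rewrite !inE !negb_or => /and5P[-> -> -> -> ->] //.
  have [xu wu yu] : [/\ x != u, w != u & y != u].
    move: xN wN yN'; rewrite !inE !negb_or.
    by move=> /and3P[-> _ _] /and3P[-> _ _] /and3P[-> _ _].
  have /side : ~~ far r u y.
    apply/negP => fy; have := fu _ _ _ _ fxw fy.
    by rewrite !(eq_sym u) (negPf xu) (negPf wu).
  case/(_ yN')/orP => H.
    have := fu _ _ _ _ fxw (far_ab _ _ yN' wN H wb).
    by rewrite (negPf yx) (negPf yw).
  have := fu _ _ _ _ fxw (far_ab _ _ xN yN' xa H).
  by rewrite (negPf yx) (negPf yw) !andbF.
(* In degree 1, common neighbours with [u] can only be [a]. So [u] is far from [a], and any other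
   vertex missed by [a] would give a second far pair. *)
rewrite ltnS leq_eqVlt => /orP[/cards1P[a E]|].
  have {}nbr w : r u w = (w == a) by rewrite nbr E !inE.
  have fa : far r u a.
    apply: u_far => [|c]; first by rewrite eq_sym N // nbr.
    by rewrite nbr => /eqP ->; rewrite rI.
  exists a => w wa; have [->|wu] := eqVneq w u; first by rewrite rS nbr.
  apply: contraT => aw; have fw : far r u w.
    by apply: u_far => // c; rewrite nbr => /eqP ->; rewrite rS.
  have := fu _ _ _ _ fa fw; by rewrite eqxx (negPf wa) (negPf wu) !andbF.
(* An isolated [u] is far from all other vertices, which are too many. *)
rewrite ltnS leqn0 => /eqP/cards0_eq E.
have {}nbr w : r u w = false by rewrite nbr E inE.
have fw w : w != u -> far r u w by move=> wu; apply: u_far => // c; rewrite nbr.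
have [x] : exists x, x \notin [:: u] by apply/exists_notin/(leq_trans _ V6).
rewrite inE => xu.
have [y] : exists y, y \notin [:: u; x] by apply/exists_notin/(leq_trans _ V6).
rewrite !inE negb_or => /andP[yu yx].
have := fu _ _ _ _ (fw _ xu) (fw _ yu).
by rewrite eqxx (negPf yx) (negPf yu) !andbF.
Qed.

(** * Listing a matching with at most one unmatched vertex *)

Lemma matching_enum (V : finType) (r : rel V) (S : {set V}) :
    symmetric r -> irreflexive r ->
    {in S & &, forall x y z, r x y -> r x z -> y = z} ->
    {in S &, forall x y, {in S, forall z, ~~ r x z} ->
       {in S, forall z, ~~ r y z} -> x = y} ->
  exists s : seq V, [/\ uniq s, s =i S & forall x0 i j,
    i < size s -> j < size s -> r (nth x0 s i) (nth x0 s j) =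
      (~~ odd i && (j == i.+1)) || (~~ odd j && (i == j.+1))].
Proof.
move=> rS rI; have [n] := ubnP #|S|; elim: n S => // n IHn S Sn m1 i1.
(* Without an edge, all vertices of [S] are isolated, so there is at most one. *)
have [/existsP[x /existsP[y /and3P[xS yS rxy]]]|H] :=
  boolP [exists x, exists y, [&& x \in S, y \in S & r x y]]; last first.
  have iso x : x \in S -> {in S, forall z, ~~ r x z}.
    move=> xS z zS; apply: contraNN H => rxz.
    by apply/existsP; exists x; apply/existsP; exists z; rewrite xS zS.
  exists (enum S); split=> [||x0 i j].
  - exact: enum_uniq.
  - by move=> x; rewrite mem_enum.
  rewrite -cardE => iS jS.
  have : #|S| <= 1.
    by apply/card_le1_eqP => x y xS yS; apply: i1 => //; apply: iso.
  by case: i iS => [|i] iS; case: j jS => [|j] jS; rewrite ?rI //; lia.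
have xy : x != y by apply: contraTneq rxy => ->; rewrite rI.
pose S' := S :\ x :\ y.
have S'P z : z \in S' -> [/\ z != x, z != y & z \in S].
  by rewrite !inE => /and3P[-> -> ->].
have S'S z : z \in S' -> z \in S by case/S'P.
have nx z : z \in S' -> r x z = false.
  case/S'P => _ zy zS; apply: contraNF zy => rxz.
  by apply/eqP; apply: (m1 x).
have ny z : z \in S' -> r y z = false.
  case/S'P => zx _ zS; apply: contraNF zx => ryz.
  by apply/eqP; apply: (m1 y) => //; rewrite rS.
have iso z : z \in S' -> {in S', forall t, ~~ r z t} ->
    {in S, forall t, ~~ r z t}.
  move=> zS' zi t tS; have [->|tx] := eqVneq t x; first by rewrite rS nx.
  have [->|ty] := eqVneq t y; first by rewrite rS ny.
  by apply: zi; rewrite !inE tx ty.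
have [s [us sS' sr]] : exists s : seq V, [/\ uniq s, s =i S' & forall x0 i j,
    i < size s -> j < size s -> r (nth x0 s i) (nth x0 s j) =
      (~~ odd i && (j == i.+1)) || (~~ odd j && (i == j.+1))].
  apply: IHn.
  - have := cardsD1 x S; have := cardsD1 y (S :\ x).
    by rewrite xS !inE eq_sym xy yS -/S' /=; move: Sn; clear; lia.
  - by move=> a b c /S'S aS /S'S bS /S'S cS; apply: m1.
  - by move=> a b aS bS /(iso _ aS) ai /(iso _ bS); apply: i1 => //; apply: S'S.
(* Putting the edge in front shifts positions by two, which preserves parities and keeps an
   unmatched vertex last. *)
exists [:: x, y & s]; split.
- rewrite /= us !inE negb_or xy !sS' !inE !eqxx /=.
  by rewrite andbF.
- move=> z; rewrite !inE sS' !inE.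
  have [->|] := eqVneq z x; first by rewrite xS.
  by have [->|] := eqVneq z y; first by rewrite yS.
move=> x0 [|[|i]] [|[|j]] //= il jl; rewrite ?rI ?rxy //.
- by rewrite nx ?andbF // -sS' mem_nth.
- by rewrite rS rxy.
- by rewrite ny ?andbF // -sS' mem_nth.
- by rewrite rS nx ?andbF // -sS' mem_nth.
- by rewrite rS ny ?andbF // -sS' mem_nth.
- by rewrite sr // !negbK !eqSS.
Qed.

(** * Even cycles and the friendship graph *)

Lemma val_ordS (k : nat) (i : 'I_k) :
  ordS i = (if i.+1 == k then 0 else i.+1) :> nat.
Proof.
have ik := ltn_ord i; rewrite /=; case: eqP => [->|/eqP ne].
  by rewrite modnn.
by rewrite modn_small // ltn_neqAle ne.
Qed.

Lemma free_even_cycle_free (V : finType) (G : sgraph V) :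
  free even_cycles G -> even_cycle_free (adj G).
Proof.
move=> Gfree c uc cc c2; apply: contraT => c_even; exfalso.
apply: (Gfree (size c) (cycle_graph (size c))); first by split.
case: c uc cc c2 c_even => // x p up cp p2 _.
exists (fun i : 'I_(size (x :: p)) => nth x (x :: p) i) => [i j /eqP|].
  by rewrite nth_uniq // => /eqP/val_inj.
have adjS (i : 'I_(size (x :: p))) :
    adj G (nth x (x :: p) i) (nth x (x :: p) (ordS i)).
  move: cp => /(pathP x)/(_ i); rewrite size_rcons => /(_ (ltn_ord i)).
  rewrite -rcons_cons nth_rcons ltn_ord val_ordS nth_rcons.
  have := ltn_ord i; rewrite [size (x :: p)]/= eqSS ltnS leq_eqVlt.
  by case: ltngtP => // ->; rewrite ?ltnn ?eqxx.
move=> i j; rewrite adj_graph_of => /andP[_ /orP[]/eqP->]; first exact: adjS.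
by rewrite adj_sym.
Qed.

Lemma adj_friendship (n : nat) (x y : 'I_n) :
  adj (friendship n) x y = (x != y :> nat) &&
    [|| x == 0 :> nat, odd x && (y == x.+1 :> nat), y == 0 :> nat
      | odd y && (x == y.+1 :> nat)].
Proof. by rewrite adj_graph_of -val_eqE -!orbA. Qed.

(** At most one vertex of the cycle goes to the centre. Since the length is at least 4, the three
    vertices after it go to leaves, and the middle leaf would have two leaf neighbours. *)
Lemma friendship_free (n : nat) : free even_cycles (friendship n).
Proof.
move=> k _ [k2 k_even ->] [f fI fadj].
have k4 : 3 < k by move: k2 k_even; clear; lia.
have fadjS i : adj (friendship n) (f i) (f (ordS i)).
  apply: fadj; rewrite adj_graph_of eqxx andbT -(inj_eq (@ord_inj k)) val_ordS.
  by have := ltn_ord i; move: k4; clear; case: (i.+1 =P k); lia.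
have [i0 i0P] : exists i0, forall j, j != i0 -> f j != 0 :> nat.
  have [/existsP[i0 /eqP fi0]|/existsPn H] := boolP [exists i, f i == 0 :> nat].
    exists i0 => j; apply: contra_neq => fj.
    by apply/fI/ord_inj; rewrite fj.
  (* If the cycle avoids the centre, any [i0] will do. *)
  by exists (Ordinal (ltnW (ltnW (ltnW k4)))).
pose a := ordS i0; pose b := ordS a; pose c := ordS b.
have [ai bi ci ac] : [/\ a != i0, b != i0, c != i0 & a != c].
  rewrite -!(inj_eq (@ord_inj k)); have := ltn_ord i0; move: k4.
  have := val_ordS i0; have := val_ordS a; have := val_ordS b.
  rewrite -/a -/b -/c; clear.
  case: (a.+1 =P k); case: (b.+1 =P k); case: (i0.+1 =P k); split; lia.
have := fadjS a; have := fadjS b; rewrite -/b -/c !adj_friendship.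
have := i0P _ ai; have := i0P _ bi; have := i0P _ ci.
have : f a != f c :> nat.
  by apply: contra_neq ac => /val_inj/fI.
by clear; lia.
Qed.

Lemma degree_friendship0 (n : nat) : degree (friendship n.+1) ord0 = n.
Proof.
rewrite /degree -[RHS]/(n.+1.-1) -[n.+1 in RHS]card_ord -cardsT.
rewrite (cardsD1 ord0 setT) inE /=; apply: eq_card => w.
by rewrite !inE adj_friendship -val_eqE /= eq_sym !andbT.
Qed.

Lemma degree_friendship_leaf (n : nat) (i : 'I_n) :
  degree (friendship n.+1) (lift ord0 i) =
  if odd i.+1 && (i.+1 == n) then 1 else 2.
Proof.
pose v := lift ord0 i; have vE : v = i.+1 :> nat by rewrite lift0.
have i_n := ltn_ord i; rewrite /degree -/v; case: ifP => H.
  rewrite -(cards1 (ord0 : 'I_n.+1)); apply: eq_card => w.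
  rewrite !inE adj_friendship -val_eqE vE /=.
  by have := ltn_ord w; move: H; clear; lia.
(* [p] is the label matched with the leaf [i.+1]. *)
pose p := if odd i.+1 then i.+2 else i.
have pn : p < n.+1 by rewrite /p; move: H i_n; clear; case: ifP; lia.
have -> : 2 = #|[set ord0; Ordinal pn]|.
  rewrite cards2 -val_eqE /=; suff -> : 0 != p by [].
  by rewrite /p; clear; case: ifP; lia.
apply: eq_card => w; rewrite !inE adj_friendship -!val_eqE vE /= /p.
by have := ltn_ord w; move: H i_n; clear; case: ifP; lia.
Qed.

(** The centre contributes [n ^ 2] and each leaf 4, except that the unmatched leaf for odd [n]
    contributes 1; the defect 3 is added on the left to avoid truncated subtraction. *)
Lemma e2_friendship (n : nat) :
  0 < n -> e2 (friendship n.+1) + 3 * odd n = n ^ 2 + 4 * n.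
Proof.
case: n => // n _; rewrite /e2 big_ord_recl degree_friendship0.
under eq_bigr do rewrite degree_friendship_leaf.
rewrite big_ord_recr /= eqxx andbT.
rewrite (eq_bigr (fun=> 4)) => [|i _]; last first.
  by rewrite eqSS (ltn_eqF (ltn_ord i)) andbF.
rewrite sum_nat_const card_ord; case: (odd n) => /=; lia.
Qed.

(** * Isomorphism and the extremal comparison *)

Lemma isomorphic_sym (U V : finType) (G : sgraph U) (H : sgraph V) :
  isomorphic G H -> isomorphic H G.
Proof.
move=> [f [g fK gK] fadj]; exists g; first by exists f.
by move=> x y; rewrite -fadj !gK.
Qed.

Lemma isomorphic_e2 (U V : finType) (G : sgraph U) (H : sgraph V) :
  isomorphic G H -> e2 G = e2 H.
Proof.
move=> [f fB fadj]; rewrite /e2 [RHS](reindex f) /=; last exact: onW_bij.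
apply: eq_bigr => x _; congr (_ ^ 2); rewrite /degree.
rewrite -(card_imset _ (bij_inj fB)); apply: eq_card => w.
have [g fK gK] := fB; rewrite -[w]gK (mem_imset _ _ (bij_inj fB)).
by rewrite !inE fadj.
Qed.

Lemma isomorphic_free (F : Defs.family) (U V : finType) (G : sgraph U)
    (H : sgraph V) :
  isomorphic G H -> free F H -> free F G.
Proof.
move=> [f fB fadj] Hfree k K FK [h hI hadj]; apply: (Hfree k K FK).
exists (f \o h); first exact: inj_comp (bij_inj fB) hI.
by move=> x y /hadj; rewrite /= fadj.
Qed.

(** Two leaves adjacent to a leaf [x] are common neighbours of [x] and [b], so they coincide. A leaf
    with no leaf neighbour is far from [b], so there is at most one. Hence [matching_enum] applies
    to the leaves. *)
Lemma dominating_isomorphic (n : nat) (G : graph n.+1) b :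
    even_cycle_free (adj G) -> #|[set p | far (adj G) p.1 p.2]| < 4 ->
    (forall w, w != b -> adj G b w) ->
  isomorphic G (friendship n.+1).
Proof.
move=> ecf D4 dom; have rS := adj_sym G; have rI := adj_irrefl G.
pose S := [set~ b].
have SE x : (x \in S) = (x != b) by rewrite !inE.
have [||s [us sS sr]] := @matching_enum _ (adj G) S rS rI.
- move=> x y z; rewrite !SE => xb yb zb xy xz.
  by apply: (common_nbr_uniq rS rI ecf xb) => //; apply: dom.
- have far_b z : z != b -> {in S, forall t, ~~ adj G z t} -> far (adj G) z b.
    move=> zb zi; rewrite /far zb /=; apply/existsPn => t.
    have [->|tb] := eqVneq t b; first by rewrite rI andbF.
    by rewrite (negPf (zi t _)) // SE.
  move=> x y; rewrite !SE => xb yb /(far_b _ xb) fx /(far_b _ yb) fy.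
  have := far_uniq D4 fx fy; rewrite (negPf yb) orbF.
  by case/andP => /eqP.
have bs : b \notin s by rewrite sS SE eqxx.
have ss : size s = n.
  rewrite -(card_uniqP us) (eq_card sS) /S.
  by have := cardsC1 b; rewrite card_ord.
(* With [b] at position 0, the list [s] shifts by one, so its pairs at positions 0 and 1, 2 and 3,
   ... get the labels 1 and 2, 3 and 4, ... of [friendship]. *)
apply: isomorphic_sym; pose f (i : 'I_n.+1) := nth b (b :: s) i.
have fI : injective f.
  move=> i j /eqP; rewrite nth_uniq /= ?ss ?bs //.
  by move/eqP/val_inj.
exists f; first exact: injF_bij.
have f0 (j : nat) : j < n -> adj G b (nth b s j).
  by move=> jn; apply: dom; rewrite -SE -sS mem_nth // ss.
move=> [[|i] il] [[|j] jl]; rewrite adj_friendship /f /=.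
- by rewrite rI.
- by rewrite f0.
- by rewrite rS f0 // !orbT.
rewrite sr ?ss //; move: il jl; clear; lia.
Qed.

Lemma e2_deg_in (V : finType) (G : sgraph V) :
  e2 G = \sum_x deg_in (adj G) setT x ^ 2.
Proof.
apply: eq_bigr => x _; congr (_ ^ 2).
by apply: eq_card => y; rewrite !inE.
Qed.

Lemma free_isomorphic_or_lt (n : nat) (G : graph n.+1) :
    5 < n -> free even_cycles G ->
  isomorphic G (friendship n.+1) \/ e2 G < e2 (friendship n.+1).
Proof.
move=> n5 /free_even_cycle_free ecf.
have rS := adj_sym G; have rI := adj_irrefl G.
have [D4|D4] := ltnP #|[set p | far (adj G) p.1 p.2]| 4.
  left; have [|b dom] := dominating_vertex rS rI ecf _ D4.
    by rewrite card_ord.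
  exact: dominating_isomorphic dom.
(* Here [e2 G] is at most 3n + n(n + 1) - 4 = n^2 + 4n - 4, whereas the friendship graph reaches at
   least n^2 + 4n - 3. *)
right; have := sum_sq_deg rS rI ecf; rewrite -e2_deg_in card_ord.
have T0 : [set: 'I_n.+1] != set0 by apply/set0Pn; exists ord0.
have := sum_deg_le rS rI ecf T0; rewrite cardsT card_ord.
rewrite (eq_bigl predT) => [|x]; last by rewrite inE.
have := @e2_friendship n (leq_trans (isT : 0 < 6) n5).
by move: D4; clear; case: (odd n) => /=; rewrite -mulnn; lia.
Qed.

Theorem theorem1p3 :
  exists N : nat, forall n : nat, N <= n ->
    t2 n even_cycles = e2 (friendship n) /\
    forall G : graph n,
      (free even_cycles G /\ e2 G = t2 n even_cycles) <->
      isomorphic G (friendship n).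
Proof.
(* Seven vertices are what [dominating_vertex] asks for. *)
exists 7 => -[//|n] n6.
have t2E : t2 n.+1 even_cycles = e2 (friendship n.+1).
  apply/eqP; rewrite eqn_leq; apply/andP; split.
    apply/bigmax_leqP => G /asboolP Gfree.
    have [/isomorphic_e2->//|/ltnW//] := free_isomorphic_or_lt n6 Gfree.
  by apply: leq_bigmax_cond; apply/asboolP; apply: friendship_free.
split=> // G; rewrite t2E; split=> [[Gfree GE]|GF].
  by have [//|] := free_isomorphic_or_lt n6 Gfree; rewrite GE ltnn.
split; last exact: isomorphic_e2.
by apply: isomorphic_free GF _; apply: friendship_free.
Qed.
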